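(* Let $z\in\mathbb{C}$, $z\neq 0$. Let $m,n,p,q$ be integers with $1\le m\le q$ and $1\le n\le p$, let $\alpha, a_2,\dots,a_p, b_2,\dots,b_q\in\mathbb{C}$ and let $\lambda, A_2,\dots,A_p, B_2,\dots,B_q>0$. Assume that the three H-functions below exist, with their defining integrals convergent along a common contour $L$ that has the required pole-separation property for each of them. Then $$ \begin{aligned} H_{p,q}^{m,n}&\left[z\;\bigg|\begin{array}{c}(\alpha,\lambda),(a_2,A_2),\ldots,(a_p,A_p)\\(\alpha,\lambda),(b_2,B_2),\ldots,(b_q,B_q)\end{array}\right]\\ &= e^{i\pi\alpha}\,H_{p,q}^{m,n}\left[e^{-i\pi\lambda}z\;\bigg|\begin{array}{c}(2\alpha,2\lambda),(a_2,A_2),\ldots,(a_p,A_p)\\(2\alpha,2\lambda),(b_2,B_2),\ldots,(b_q,B_q)\end{array}\right]\\ &\quad+ e^{-i\pi\alpha}\,H_{p,q}^{m,n}\left[e^{i\pi\lambda}z\;\bigg|\begin{array}{c}(2\alpha,2\lambda),(a_2,A_2),\ldots,(a_p,A_p)\\(2\alpha,2\lambda),(b_2,B_2),\ldots,(b_q,B_q)\end{array}\right]. \end{aligned} $$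
   Context: For integers $0\le m\le q$, $0\le n\le p$, complex numbers $a_j,b_j$ and positive real numbers $A_j,B_j$, the H-function is defined by $$ H_{p,q}^{m,n}\left[z\;\bigg|\begin{array}{c}(a_1,A_1),\ldots,(a_p,A_p)\\(b_1,B_1),\ldots,(b_q,B_q)\end{array}\right]=\frac{1}{2\pi i}\int_L\frac{\prod_{j=1}^{m}\Gamma(b_j+B_js)\prod_{j=1}^{n}\Gamma(1-a_j-A_js)}{\prod_{j=m+1}^{q}\Gamma(1-b_j-B_js)\prod_{j=n+1}^{p}\Gamma(a_j+A_js)}\,z^{-s}\,ds , $$ where the contour $L$ runs from $c-i\infty$ to $c+i\infty$ (for some real $c$) in such a way that the poles of $\Gamma(b_j+B_js)$, $j=1,\dots,m$, lie to the left of $L$ and the poles of $\Gamma(1-a_j-A_js)$, $j=1,\dots,n$, lie to the right of $L$. The H-function exists when such a contour exists and the integral converges. Empty products equal $1$. Powers: $z^{-s}=\exp(-s(\log|z|+i\arg z))$ for a fixed choice of $\arg z$, and the argument of $e^{\mp i\pi\lambda}z$ is taken to be $\arg z\mp\pi\lambda$ (it is not reduced modulo $2\pi$), so that $(e^{\mp i\pi\lambda}z)^{-s}=e^{\pm i\pi\lambda s}z^{-s}$. *)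

(* Defs.v *)
From Stdlib Require Export Reals Factorial Lra Lia List.
From Coquelicot Require Export Coquelicot.

Open Scope C_scope.

Definition Cexp (s : C) : C :=
  ((exp (Re s) * cos (Im s))%R, (exp (Re s) * sin (Im s))%R).

(* z^s for the branch in which arg z is theta.  Nothing forces theta to lie in
   a fixed interval: it is a choice of argument, carried along with z. *)
Definition Cpower (z : C) (theta : R) (s : C) : C :=
  Cexp (s * (RtoC (ln (Cmod z)) + Ci * RtoC theta)).

(** * The Gamma function *)

Definition CLim_seq (u : nat -> C) : C :=
  (real (Lim_seq (fun n => Re (u n))), real (Lim_seq (fun n => Im (u n)))).

(* s (s + 1) ... (s + n), with n + 1 factors. *)
Fixpoint rising (s : C) (n : nat) : C :=
  match n with
  | O => s
  | S n' => rising s n' * (s + RtoC (INR n))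
  end.

(* The Euler-Gauss definition
     Gamma(s) = lim_n  n! n^s / (s (s + 1) ... (s + n)),
   valid on the whole plane minus the poles 0, -1, -2, ... *)
Definition Gamma_seq (s : C) (n : nat) : C :=
  RtoC (INR (fact n)) * Cpower (RtoC (INR n)) 0 s / rising s n.

Definition Gamma (s : C) : C := CLim_seq (Gamma_seq s).

Definition Gamma_pole (s : C) : Prop := exists k : nat, s = - RtoC (INR k).

(* 1/Gamma is entire and vanishes at the poles of Gamma.  Since / 0 = 0, the
   total function Gamma takes the value 0 there, and so does its inverse:
   a quotient by Gamma has the right value even at the poles. *)
Lemma Cinv_0 : / RtoC 0 = RtoC 0.
Proof.
apply injective_projections; simpl; unfold Rdiv; rewrite ?Ropp_0;
  apply Rmult_0_l.
Qed.

Lemma rising_pole (k n : nat) :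
  (k <= n)%nat -> rising (- RtoC (INR k)) n = RtoC 0.
Proof.
intros Hk; induction n as [|n IH].
- replace k with O by lia. simpl. apply injective_projections; simpl; ring.
- destruct (Nat.eq_dec k (S n)) as [->|Hne].
  + change (rising (- RtoC (INR (S n))) n *
      (- RtoC (INR (S n)) + RtoC (INR (S n))) = RtoC 0).
    rewrite (Cplus_comm (- _)), Cplus_opp_r. apply Cmult_0_r.
  + change (rising (- RtoC (INR k)) n *
      (- RtoC (INR k) + RtoC (INR (S n))) = RtoC 0).
    rewrite IH by lia. apply Cmult_0_l.
Qed.

Lemma Gamma_at_pole (s : C) : Gamma_pole s -> Gamma s = RtoC 0.
Proof.
intros [k ->].
assert (H0 : forall n, (k <= n)%nat -> Gamma_seq (- RtoC (INR k)) n = RtoC 0).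
{ intros n Hn. unfold Gamma_seq, Cdiv.
  rewrite (rising_pole k n Hn), Cinv_0. apply Cmult_0_r. }
assert (Hlim : forall f : C -> R, f (RtoC 0) = 0%R ->
  Lim_seq (fun n => f (Gamma_seq (- RtoC (INR k)) n)) = Finite 0).
{ intros f Hf. rewrite <- (Lim_seq_const 0). apply Lim_seq_ext_loc.
  exists k. intros n Hn. rewrite (H0 n Hn). exact Hf. }
unfold Gamma, CLim_seq. rewrite 2!Hlim by reflexivity. reflexivity.
Qed.

Lemma inv_Gamma_at_pole (s : C) : Gamma_pole s -> / Gamma s = RtoC 0.
Proof. intros Hs. rewrite (Gamma_at_pole s Hs). exact Cinv_0. Qed.

(** * Contours *)

Definition velocity (L : R -> C) (t : R) : C :=
  (Derive (fun u => Re (L u)) t, Derive (fun u => Im (L u)) t).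

(* The breakpoints are isolated, and both one-sided limits of the velocity
   exist at each of them. *)
Definition piecewise_C1 (L : R -> C) : Prop :=
  forall t : R,
    continuous (L : R -> C_R_NormedModule) t /\
    locally' t (fun u =>
      ex_derive (L : R -> C_R_NormedModule) u /\
      continuous (velocity L : R -> C_R_NormedModule) u) /\
    (exists v : C_R_NormedModule,
      filterlim (velocity L) (at_left t) (locally v)) /\
    (exists v : C_R_NormedModule,
      filterlim (velocity L) (at_right t) (locally v)).

(* A simple curve running from c - i oo to c + i oo. *)
Definition vertical_contour (c : R) (L : R -> C) : Prop :=
  piecewise_C1 L /\
  (forall t u : R, L t = L u -> t = u) /\
  is_lim (fun t => Re (L t)) m_infty c /\
  is_lim (fun t => Re (L t)) p_infty c /\
  is_lim (fun t => Im (L t)) m_infty m_infty /\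
  is_lim (fun t => Im (L t)) p_infty p_infty.

(* Along a vertical contour Re is bounded, so L misses some half-planes
   Re s < -M and Re s > M.  A point is on the left (right) of L when it can be
   joined to the former (latter) without meeting L; this is expressed by a path
   w on [0, +oo) along which Re tends to -oo (+oo). *)
Definition escapes (L : R -> C) (s : C) (e : Rbar) : Prop :=
  exists w : R -> C,
    w 0%R = s /\
    (forall t : R, (0 <= t)%R -> continuous (w : R -> C_R_NormedModule) t) /\
    (forall t u : R, (0 <= t)%R -> w t <> L u) /\
    is_lim (fun t => Re (w t)) p_infty e.

Definition left_of (L : R -> C) (s : C) : Prop := escapes L s m_infty.
Definition right_of (L : R -> C) (s : C) : Prop := escapes L s p_infty.

(* The integral of f along L is that of t |-> f (L t) L'(t) over R. *)
Definition pullback (L : R -> C) (f : C -> C) : R -> C_R_CompleteNormedModule :=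
  fun t => f (L t) * velocity L t.

Definition ex_CInt (L : R -> C) (f : C -> C) : Prop :=
  ex_RInt_gen (pullback L f) (Rbar_locally m_infty) (Rbar_locally p_infty).

Definition CInt (L : R -> C) (f : C -> C) : C :=
  RInt_gen (pullback L f) (Rbar_locally m_infty) (Rbar_locally p_infty).

(** * The H-function *)

Definition Cprod (l : list C) : C := fold_right Cmult (RtoC 1) l.

(* The parameters are the two rows of the H-symbol: top lists the (a_j, A_j),
   j = 1, ..., p, and bot lists the (b_j, B_j), j = 1, ..., q. *)
Definition H_kernel (m n : nat) (top bot : list (C * R)) (s : C) : C :=
  (Cprod (map (fun x => Gamma (fst x + RtoC (snd x) * s)) (firstn m bot)) *
   Cprod (map (fun x => Gamma (RtoC 1 - fst x - RtoC (snd x) * s))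
            (firstn n top))) /
  (Cprod (map (fun x => Gamma (RtoC 1 - fst x - RtoC (snd x) * s))
            (skipn m bot)) *
   Cprod (map (fun x => Gamma (fst x + RtoC (snd x) * s)) (skipn n top))).

Definition H_integrand (m n : nat) (z : C) (theta : R) (top bot : list (C * R))
  (s : C) : C := H_kernel m n top bot s * Cpower z theta (- s).

Definition separates (L : R -> C) (m n : nat) (top bot : list (C * R)) : Prop :=
  (forall x s, In x (firstn m bot) ->
     Gamma_pole (fst x + RtoC (snd x) * s) -> left_of L s) /\
  (forall x s, In x (firstn n top) ->
     Gamma_pole (RtoC 1 - fst x - RtoC (snd x) * s) -> right_of L s).

Definition H_exists (L : R -> C) (m n : nat) (z : C) (theta : R)
  (top bot : list (C * R)) : Prop :=
  (exists c : R, vertical_contour c L) /\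
  separates L m n top bot /\
  ex_CInt L (H_integrand m n z theta top bot).

(* The H-function of z, with arg z = theta, computed along the contour L. *)
Definition H_fun (L : R -> C) (m n : nat) (z : C) (theta : R)
  (top bot : list (C * R)) : C :=
  / (RtoC 2 * RtoC PI * Ci) * CInt L (H_integrand m n z theta top bot).

(* Main.v *)
Require Import Defs.

(* Put w = alpha + lambda s.  Euler's reflection formula gives
     Gamma(w) Gamma(1 - w) = pi / sin(pi w)
       = (e^(i pi w) + e^(-i pi w)) Gamma(2 w) Gamma(1 - 2 w),
   so the three integrands satisfy the identity pointwise on the contour, where
   2 w is not an integer because the contour separates the poles.

   The reflection formula comes from the moments
     I_n(w) = int_0^(pi/2) cos(2 w t) cos(t)^(2 n) dt.
   Integrating by parts twice, 4 (n^2 - w^2) I_n(w) = 2 n (2 n - 1) I_(n-1)(w),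
   while 2 w I_0(w) = sin(pi w) and I_n(w) / I_n(0) tends to 1: this is the sine
   product, and its partial products are those of Gamma(w) Gamma(1 - w) in the
   Euler-Gauss definition. *)

Local Open Scope R_scope.

(** * Moments against even powers of the cosine *)

Lemma ex_RInt_mult_cos_pow (f f' : R -> R) (n : nat) (a b : R) :
  (forall t, is_derive f t (f' t)) ->
  ex_RInt (fun t => f t * cos t ^ n) a b.
Proof.
intros Hf. apply (ex_RInt_continuous (V := R_CompleteNormedModule)). intros t _.
apply (ex_derive_continuous (V := R_NormedModule)). auto_derive. repeat split.
now exists (f' t).
Qed.

(** The factor [f] is an arbitrary real function, so that the same lemmas serve the constant 1 and
    the real and imaginary parts of cos(2 w t). *)
Definition cos_moment (f : R -> R) (n : nat) : R :=
  RInt (fun t => f t * cos t ^ (2 * n)) 0 (PI / 2).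

Lemma is_RInt_cos_moment (f f' : R -> R) (n : nat) :
  (forall t, is_derive f t (f' t)) ->
  is_RInt (fun t => f t * cos t ^ (2 * n)) 0 (PI / 2) (cos_moment f n).
Proof.
intros Hf. apply (RInt_correct (V := R_CompleteNormedModule)).
exact (ex_RInt_mult_cos_pow f f' (2 * n) 0 (PI / 2) Hf).
Qed.

(* Integrates the derivative of [f' cos^(2n+2) + (2n+2) f cos^(2n+1) sin]. *)
Lemma cos_moment_S (f f' f'' f''' : R -> R) (n : nat) :
  (forall t, is_derive f t (f' t)) ->
  (forall t, is_derive f' t (f'' t)) ->
  (forall t, is_derive f'' t (f''' t)) ->
  f' 0 = 0 ->
  cos_moment f'' (S n) + (2 * INR n + 2) ^ 2 * cos_moment f (S n) =
  (2 * INR n + 2) * (2 * INR n + 1) * cos_moment f n.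
Proof.
intros H0 H1 H2 Hz.
assert (Hd : forall t, is_derive
  (fun t => f' t * cos t ^ (2 * S n)
            + (2 * INR n + 2) * (f t * (cos t ^ (2 * n + 1) * sin t))) t
  (f'' t * cos t ^ (2 * S n) + (2 * INR n + 2) ^ 2 * (f t * cos t ^ (2 * S n))
   - (2 * INR n + 2) * (2 * INR n + 1) * (f t * cos t ^ (2 * n)))).
{ intros t.
  replace (2 * S n)%nat with (2 * n + 2)%nat by lia.
  auto_derive.
  - repeat split; [now exists (f'' t) | now exists (f' t)].
  - replace (Derive (fun x : R => f x) t) with (f' t)
      by (symmetry; apply is_derive_unique, H0).
    replace (Derive (fun x : R => f' x) t) with (f'' t)
      by (symmetry; apply is_derive_unique, H1).
    change (n + (n + 0))%nat with (2 * n)%nat.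
    replace (Nat.pred (2 * n + 2)) with (2 * n + 1)%nat by lia.
    replace (Nat.pred (2 * n + 1)) with (2 * n)%nat by lia.
    generalize (sin2_cos2 t). unfold Rsqr. intros Hs.
    rewrite !pow_add, !plus_INR, !mult_INR. simpl INR.
    set (P := cos t ^ (2 * n)).
    transitivity (f'' t * (P * cos t ^ 2)
      + (2 * INR n + 2) * f t * P * (cos t ^ 2 - (2 * INR n + 1) * (sin t * sin t)));
      [ring|].
    (* Eliminating sin^2 leaves only the weights cos^(2n) and cos^(2n+2), which are those of the two
       moments. *)
    replace (sin t * sin t) with (1 - cos t * cos t) by lra.
    ring. }
assert (HI : is_RInt (fun t => f'' t * cos t ^ (2 * S n)
   + (2 * INR n + 2) ^ 2 * (f t * cos t ^ (2 * S n))
   - (2 * INR n + 2) * (2 * INR n + 1) * (f t * cos t ^ (2 * n))) 0 (PI / 2)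
   (cos_moment f'' (S n) + (2 * INR n + 2) ^ 2 * cos_moment f (S n)
    - (2 * INR n + 2) * (2 * INR n + 1) * cos_moment f n)).
{ assert (E2 := is_RInt_cos_moment f'' f''' (S n) H2).
  assert (E0 := is_RInt_cos_moment f f' (S n) H0).
  assert (E0' := is_RInt_cos_moment f f' n H0).
  exact (is_RInt_minus _ _ _ _ _ _
    (is_RInt_plus _ _ _ _ _ _ E2 (is_RInt_scal _ _ _ _ _ E0))
    (is_RInt_scal _ _ _ _ _ E0')). }
apply (is_RInt_unique (V := R_CompleteNormedModule)) in HI.
assert (HJ := is_RInt_derive (V := R_CompleteNormedModule) _ _ 0 (PI / 2)
  (fun t _ => Hd t)).
assert (HK := fun H => is_RInt_unique (V := R_CompleteNormedModule) _ _ _ _ (HJ H)).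
clear HJ.
rewrite HI in HK.
assert (HL := HK ltac:(intros t _;
  apply (ex_derive_continuous (V := R_NormedModule)); auto_derive;
  repeat split; [now exists (f''' t) | now exists (f' t) | now exists (f' t)])).
unfold minus, plus, opp in HL; simpl in HL.
(* Both boundary terms vanish: at PI / 2 because each carries a positive power of cos, at 0 because
   [f' 0 = 0] and sin 0 = 0. *)
rewrite Hz, cos_PI2, sin_0 in HL.
rewrite Nat.add_1_r in HL.
replace (n + S (n + 0))%nat with (S (n + n)) in HL by lia.
simpl in HL. simpl. lra.
Qed.

Lemma MVT_half_line (f f' : R -> R) (t : R) :
  (forall t, is_derive f t (f' t)) -> 0 <= t ->
  exists c, 0 <= c <= t /\ f t - f 0 = f' c * t.
Proof.
intros H Ht.
destruct (MVT_gen f 0 t f') as [c [Hc Hm]].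
- intros x _. apply H.
- intros x _. apply continuity_pt_filterlim.
  apply (ex_derive_continuous f). now exists (f' x).
- rewrite Rmin_left, Rmax_right in Hc by assumption.
  exists c. split; [assumption|]. rewrite Hm. ring.
Qed.

(** The mean value theorem applied twice gives f t - f 0 = f''(d) c t with 0 <= d <= c <= t. The
    constant [K] is the maximum of |f''| on [0, b], and [f'''] provides the continuity of [f'']. *)
Lemma quadratic_bound (f f' f'' f''' : R -> R) (b : R) :
  0 <= b ->
  (forall t, is_derive f t (f' t)) ->
  (forall t, is_derive f' t (f'' t)) ->
  (forall t, is_derive f'' t (f''' t)) ->
  f' 0 = 0 ->
  exists K, 0 <= K /\ forall t, 0 <= t <= b -> Rabs (f t - f 0) <= K * t ^ 2.
Proof.
intros Hb H0 H1 H2 Hz.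
destruct (continuity_ab_maj (fun t => Rabs (f'' t)) 0 b Hb) as [M [HM _]].
{ intros t _. apply continuity_pt_filterlim.
  apply (continuous_comp f'' Rabs).
  - apply (ex_derive_continuous f''). now exists (f''' t).
  - apply continuous_Rabs. }
exists (Rabs (f'' M)). split; [apply Rabs_pos|].
intros t Ht.
destruct (MVT_half_line f f' t H0 (proj1 Ht)) as [c [Hc Ec]].
destruct (MVT_half_line f' f'' c H1 (proj1 Hc)) as [d [Hd Ed]].
rewrite Hz, Rminus_0_r in Ed. rewrite Ec, Ed, !Rabs_mult.
rewrite (Rabs_pos_eq c), (Rabs_pos_eq t) by lra.
simpl. rewrite Rmult_1_r, <- Rmult_assoc.
apply Rmult_le_compat_r; [lra|].
apply Rmult_le_compat; try lra; try apply Rabs_pos. apply HM. lra.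
Qed.

(** The difference sin t - t cos t vanishes at 0 and has derivative t sin t, which is nonnegative on
    this interval. *)
Lemma mult_cos_le_sin (t : R) : 0 <= t <= PI / 2 -> t * cos t <= sin t.
Proof.
intros Ht.
destruct (MVT_half_line (fun t => sin t - t * cos t) (fun t => t * sin t) t)
  as [c [Hc Ec]].
- intros x. auto_derive; [easy|ring].
- lra.
- rewrite sin_0 in Ec.
  assert (0 <= sin c) by (apply sin_ge_0; generalize PI_RGT_0; lra).
  assert (0 <= c * sin c * t) by (repeat apply Rmult_le_pos; lra). lra.
Qed.

(** The Wallis integral of cos^(2n) over [0, PI / 2], the normalising constant of the moments. *)
Definition wallis (n : nat) : R := cos_moment (fun _ => 1) n.

(** For f = 1 the moment of f'' drops out of [cos_moment_S], and a factor 2n + 2 cancels. *)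
Lemma wallis_S (n : nat) :
  (2 * INR n + 2) * wallis (S n) = (2 * INR n + 1) * wallis n.
Proof.
assert (H := cos_moment_S (fun _ => 1) (fun _ => 0) (fun _ => 0) (fun _ => 0) n).
assert (Hd : forall c t : R, is_derive (fun _ => c) t 0)
  by (intros; auto_derive; auto).
specialize (H (Hd 1) (Hd 0) (Hd 0) eq_refl).
fold (wallis n) (wallis (S n)) in H.
replace (cos_moment (fun _ => 0) (S n)) with 0 in H.
- apply (Rmult_eq_reg_l (2 * INR n + 2)); [lra|].
  generalize (pos_INR n). lra.
- unfold cos_moment. rewrite (RInt_ext _ (fun _ => 0)).
  + rewrite RInt_const. unfold scal; simpl; unfold mult; simpl. ring.
  + intros. apply Rmult_0_l.
Qed.

Lemma wallis_0 : wallis 0 = PI / 2.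
Proof.
unfold wallis, cos_moment. rewrite (RInt_ext _ (fun _ => 1)).
- rewrite RInt_const. unfold scal; simpl; unfold mult; simpl. lra.
- intros. apply Rmult_1_r.
Qed.

Lemma wallis_pos (n : nat) : 0 < wallis n.
Proof.
induction n as [|n IH].
- rewrite wallis_0. generalize PI_RGT_0. lra.
- apply (Rmult_lt_reg_l (2 * INR n + 2)); [generalize (pos_INR n); lra|].
  rewrite wallis_S, Rmult_0_r. apply Rmult_lt_0_compat; [|exact IH].
  generalize (pos_INR n). lra.
Qed.

(* Since [t cos t <= sin t], the deviation from [f 0] is controlled by
   [RInt (sin^2 cos^(2n)) = wallis n - wallis (n + 1)]. *)
Lemma cos_moment_bound (f f' f'' f''' : R -> R) :
  (forall t, is_derive f t (f' t)) ->
  (forall t, is_derive f' t (f'' t)) ->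
  (forall t, is_derive f'' t (f''' t)) ->
  f' 0 = 0 ->
  exists K, forall n,
    Rabs (cos_moment f (S n) / wallis (S n) - f 0) <= K / (2 * INR n + 1).
Proof.
intros H0 H1 H2 Hz.
assert (Hpi := PI_RGT_0).
destruct (quadratic_bound f f' f'' f''' (PI / 2)) as [K [HK0 HK]];
  try assumption; [lra|].
exists K. intros n.
assert (HW := wallis_pos (S n)). assert (HN := pos_INR n).
assert (Hd : forall t : R, is_derive (fun _ => 1) t 0)
  by (intros; auto_derive; auto).
assert (E0 := is_RInt_cos_moment f f' (S n) H0).
assert (E1 := is_RInt_cos_moment _ _ (S n) Hd).
assert (E2 := is_RInt_cos_moment _ _ n Hd).
fold (wallis (S n)) in E1.
fold (wallis n) in E2.
assert (F := is_RInt_minus _ _ _ _ _ _ E0 (is_RInt_scal _ _ _ (f 0) _ E1)).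
assert (G := is_RInt_scal _ _ _ K _ (is_RInt_minus _ _ _ _ _ _ E2 E1)).
assert (HB : Rabs (cos_moment f (S n) - f 0 * wallis (S n)) <=
             K * (wallis n - wallis (S n))).
(* The integrands compare pointwise: |f t - f 0| cos^(2n+2) <= K (t cos t)^2 cos^(2n) <= K sin^2
   cos^(2n), and sin^2 cos^(2n) is the difference of two consecutive Wallis integrands. *)
{ refine (norm_RInt_le _ _ 0 (PI / 2) _ _ _ _ F G); [lra|].
  intros t Ht. unfold norm, minus, plus, opp, scal; simpl.
  unfold abs, mult; simpl.
  replace (n + S (n + 0))%nat with (S (n + (n + 0))) by lia.
  set (P := cos t ^ (n + (n + 0))).
  assert (HP : 0 <= P).
  { unfold P. replace (n + (n + 0))%nat with (2 * n)%nat by lia.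
    rewrite pow_mult. apply pow_le. apply pow2_ge_0. }
  simpl; fold P.
  replace (f t * (cos t * (cos t * P)) + - (f 0 * (1 * (cos t * (cos t * P)))))
    with ((f t - f 0) * (cos t ^ 2 * P)) by ring.
  rewrite Rabs_mult, (Rabs_pos_eq (cos t ^ 2 * P))
    by (apply Rmult_le_pos; [apply pow2_ge_0|assumption]).
  apply Rle_trans with (K * t ^ 2 * (cos t ^ 2 * P)).
  { apply Rmult_le_compat_r; [|now apply HK].
    apply Rmult_le_pos; [apply pow2_ge_0|assumption]. }
  assert (Hc : 0 <= cos t) by (apply cos_ge_0; lra).
  assert (Hs := mult_cos_le_sin t Ht).
  assert (Hq : (t * cos t) ^ 2 <= sin t ^ 2).
  { apply pow_incr. split; [apply Rmult_le_pos; lra|assumption]. }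
  replace (1 * P + - (1 * (cos t * (cos t * P)))) with (sin t ^ 2 * P).
  - replace (K * t ^ 2 * (cos t ^ 2 * P)) with (K * ((t * cos t) ^ 2 * P)) by ring.
    apply Rmult_le_compat_l; [assumption|]. now apply Rmult_le_compat_r.
  - generalize (sin2_cos2 t). unfold Rsqr. intros Hsc.
    replace (sin t ^ 2) with (1 - cos t * cos t) by (simpl; lra). ring. }
(* By this recurrence, wallis n - wallis (n + 1) = wallis (n + 1) / (2n + 1), which is where the
   denominator of the bound comes from. *)
assert (HS := wallis_S n).
replace (cos_moment f (S n) / wallis (S n) - f 0)
  with ((cos_moment f (S n) - f 0 * wallis (S n)) / wallis (S n)) by (field; lra).
unfold Rdiv at 1. rewrite Rabs_mult, (Rabs_pos_eq (/ _))
  by (left; now apply Rinv_0_lt_compat).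
apply (Rmult_le_reg_r (wallis (S n))); [assumption|].
rewrite Rmult_assoc, Rinv_l, Rmult_1_r by lra.
replace (K / (2 * INR n + 1) * wallis (S n)) with (K * (wallis n - wallis (S n)));
  [assumption|].
replace (wallis n) with ((2 * INR n + 2) * wallis (S n) / (2 * INR n + 1))
  by (rewrite HS; field; lra).
field. lra.
Qed.

Lemma is_lim_seq_inv_INR (C a b : R) : 0 < a -> 0 <= b ->
  is_lim_seq (fun n => C / (a * INR n + b)) 0.
Proof.
intros Ha Hb.
replace (Finite 0) with (Rbar_mult C (Rbar_inv p_infty))
  by (simpl; now rewrite Rmult_0_r).
apply is_lim_seq_scal_l.
apply is_lim_seq_inv; [|easy].
apply is_lim_seq_le_p_loc with (fun n => a * INR n).
- exists O. intros. lra.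
- replace p_infty with (Rbar_mult a p_infty).
  + apply is_lim_seq_scal_l. apply is_lim_seq_INR.
  + apply is_Rbar_mult_unique. now apply is_Rbar_mult_sym, is_Rbar_mult_p_infty_pos.
Qed.

(** The weights cos^(2n) / wallis n form an approximate identity concentrating at t = 0;
    [cos_moment_bound] makes this quantitative, with error O(1/n). *)
Lemma is_lim_seq_cos_moment (f f' f'' f''' : R -> R) :
  (forall t, is_derive f t (f' t)) ->
  (forall t, is_derive f' t (f'' t)) ->
  (forall t, is_derive f'' t (f''' t)) ->
  f' 0 = 0 ->
  is_lim_seq (fun n => cos_moment f n / wallis n) (f 0).
Proof.
intros H0 H1 H2 Hz.
destruct (cos_moment_bound f f' f'' f''' H0 H1 H2 Hz) as [K HK].
apply is_lim_seq_incr_1.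
apply is_lim_seq_ext with
  (fun n => (cos_moment f (S n) / wallis (S n) - f 0) + f 0); [intros; ring|].
replace (Finite (f 0)) with (Rbar_plus 0 (f 0)) by (simpl; f_equal; ring).
apply is_lim_seq_plus'; [|apply is_lim_seq_const].
apply is_lim_seq_abs_0.
apply is_lim_seq_le_le with (fun _ => 0) (fun n => K / (2 * INR n + 1)).
- intros n. split; [apply Rabs_pos|apply HK].
- apply is_lim_seq_const.
- apply is_lim_seq_inv_INR; lra.
Qed.

Local Open Scope C_scope.

(** * Complex exponential, sine and cosine *)

Lemma Cexp_plus (u v : C) : Cexp (u + v) = Cexp u * Cexp v.
Proof.
unfold Cexp. rewrite re_plus, im_plus, exp_plus, cos_plus, sin_plus.
apply injective_projections; simpl; ring.
Qed.

Lemma Cexp_RtoC (x : R) : Cexp (RtoC x) = RtoC (exp x).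
Proof.
unfold Cexp; simpl. rewrite cos_0, sin_0.
apply injective_projections; simpl; ring.
Qed.

Definition Ccos (u : C) : C :=
  ((cos (Re u) * cosh (Im u))%R, (- (sin (Re u) * sinh (Im u)))%R).
Definition Csin (u : C) : C :=
  ((sin (Re u) * cosh (Im u))%R, (cos (Re u) * sinh (Im u))%R).

Lemma Cexp_Ci_plus_opp (u : C) :
  Cexp (Ci * u) + Cexp (- (Ci * u)) = RtoC 2 * Ccos u.
Proof.
destruct u as [a b]. unfold Cexp, Ccos, cosh, sinh; simpl.
replace (0 * a - 1 * b)%R with (- b)%R by ring.
replace (0 * b + 1 * a)%R with a by ring.
rewrite cos_neg, sin_neg, Ropp_involutive.
apply injective_projections; simpl; field.
Qed.

Lemma Csin_double (u : C) : Csin (RtoC 2 * u) = RtoC 2 * Csin u * Ccos u.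
Proof.
destruct u as [a b]. unfold Csin, Ccos, cosh, sinh; simpl.
replace (2 * a - 0 * b)%R with (2 * a)%R by ring.
replace (2 * b + 0 * a)%R with (b + b)%R by ring.
rewrite cos_2a, sin_2a, Ropp_plus_distr, !exp_plus, exp_Ropp.
assert (Hb := exp_pos b).
apply injective_projections; simpl; field; lra.
Qed.

(** * Moments of the complex cosine *)

Lemma cos_moment_linear (f f' g g' : R -> R) (x y : R) (n : nat) :
  (forall t, is_derive f t (f' t)) -> (forall t, is_derive g t (g' t)) ->
  cos_moment (fun t => x * f t + y * g t)%R n =
  (x * cos_moment f n + y * cos_moment g n)%R.
Proof.
intros Hf Hg.
assert (Ef := is_RInt_cos_moment f f' n Hf).
assert (Eg := is_RInt_cos_moment g g' n Hg).
apply (is_RInt_unique (V := R_CompleteNormedModule)).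
eapply is_RInt_ext;
  [|exact (is_RInt_plus _ _ _ _ _ _ (is_RInt_scal _ _ _ x _ Ef)
             (is_RInt_scal _ _ _ y _ Eg))].
intros t _. unfold plus, scal; simpl; unfold mult; simpl.
symmetry. rewrite Rmult_plus_distr_r, !Rmult_assoc. reflexivity.
Qed.

(** With c = a + i b, cos(c t) = [coscosh] + i [msinsinh] and sin(c t) = [sincosh] + i [cossinh].
    Keeping the minus sign inside [msinsinh] makes the derivatives of all four real linear
    combinations of one another. *)
Definition coscosh (a b t : R) : R := (cos (a * t) * cosh (b * t))%R.
Definition sincosh (a b t : R) : R := (sin (a * t) * cosh (b * t))%R.
Definition cossinh (a b t : R) : R := (cos (a * t) * sinh (b * t))%R.
Definition msinsinh (a b t : R) : R := (- (sin (a * t) * sinh (b * t)))%R.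

Lemma is_derive_coscosh (a b t : R) :
  is_derive (coscosh a b) t (- a * sincosh a b t + b * cossinh a b t)%R.
Proof.
unfold coscosh, sincosh, cossinh, cosh, sinh.
auto_derive; [easy|]. simpl. field.
Qed.

Lemma is_derive_msinsinh (a b t : R) :
  is_derive (msinsinh a b) t (- a * cossinh a b t + (- b) * sincosh a b t)%R.
Proof.
unfold msinsinh, sincosh, cossinh, cosh, sinh.
auto_derive; [easy|]. simpl. field.
Qed.

Lemma is_derive_sincosh (a b t : R) :
  is_derive (sincosh a b) t (a * coscosh a b t + (- b) * msinsinh a b t)%R.
Proof.
unfold coscosh, sincosh, msinsinh, cosh, sinh.
auto_derive; [easy|]. simpl. field.
Qed.

Lemma is_derive_cossinh (a b t : R) :
  is_derive (cossinh a b) t (a * msinsinh a b t + b * coscosh a b t)%R.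
Proof.
unfold coscosh, cossinh, msinsinh, cosh, sinh.
auto_derive; [easy|]. simpl. field.
Qed.

Lemma is_derive_comb (f f' g g' : R -> R) (x y : R) :
  (forall t, is_derive f t (f' t)) -> (forall t, is_derive g t (g' t)) ->
  forall t, is_derive (fun t => x * f t + y * g t)%R t (x * f' t + y * g' t)%R.
Proof.
intros Hf Hg t.
exact (is_derive_plus _ _ _ _ _ (is_derive_scal _ _ x _ (Hf t))
         (is_derive_scal _ _ y _ (Hg t))).
Qed.

(** Real part of cos(c t)'' = - c^2 cos(c t), where - c^2 = (b^2 - a^2) - 2 a b i; the next lemma is
    the imaginary part. *)
Lemma is_derive2_coscosh (a b t : R) :
  is_derive (fun t => - a * sincosh a b t + b * cossinh a b t)%R t
    ((b ^ 2 - a ^ 2) * coscosh a b t + (2 * a * b) * msinsinh a b t)%R.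
Proof.
replace ((b ^ 2 - a ^ 2) * coscosh a b t + (2 * a * b) * msinsinh a b t)%R
  with (- a * (a * coscosh a b t + (- b) * msinsinh a b t)
        + b * (a * msinsinh a b t + b * coscosh a b t))%R by ring.
apply (is_derive_comb _ _ _ _ (- a) b (is_derive_sincosh a b)
  (is_derive_cossinh a b) t).
Qed.

Lemma is_derive2_msinsinh (a b t : R) :
  is_derive (fun t => - a * cossinh a b t + (- b) * sincosh a b t)%R t
    ((b ^ 2 - a ^ 2) * msinsinh a b t + (- (2 * a * b)) * coscosh a b t)%R.
Proof.
replace ((b ^ 2 - a ^ 2) * msinsinh a b t + (- (2 * a * b)) * coscosh a b t)%R
  with (- a * (a * msinsinh a b t + b * coscosh a b t)
        + (- b) * (a * coscosh a b t + (- b) * msinsinh a b t))%R by ring.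
apply (is_derive_comb _ _ _ _ (- a) (- b) (is_derive_cossinh a b)
  (is_derive_sincosh a b) t).
Qed.

Lemma sinh_0 : sinh 0 = 0%R.
Proof. unfold sinh. rewrite Ropp_0. field. Qed.

Lemma cosh_0 : cosh 0 = 1%R.
Proof. unfold cosh. rewrite Ropp_0, exp_0. field. Qed.

Lemma coscosh_0 (a b : R) : coscosh a b 0 = 1%R.
Proof. unfold coscosh. rewrite !Rmult_0_r, cos_0, cosh_0. ring. Qed.
Lemma sincosh_0 (a b : R) : sincosh a b 0 = 0%R.
Proof. unfold sincosh. rewrite !Rmult_0_r, sin_0. ring. Qed.
Lemma cossinh_0 (a b : R) : cossinh a b 0 = 0%R.
Proof. unfold cossinh. rewrite !Rmult_0_r, sinh_0. ring. Qed.
Lemma msinsinh_0 (a b : R) : msinsinh a b 0 = 0%R.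
Proof. unfold msinsinh. rewrite !Rmult_0_r, sin_0. ring. Qed.

(* [RInt (fun t => cos (2 w t) * cos t ^ (2 n)) 0 (PI / 2)] for complex [w],
   by real and imaginary parts. *)
Definition cosine_moment (w : C) (n : nat) : C :=
  (cos_moment (coscosh (2 * Re w) (2 * Im w)) n,
   cos_moment (msinsinh (2 * Re w) (2 * Im w)) n).

(** For f(t) = cos(2 w t), f'' = - 4 w^2 f turns [cos_moment_S] into a two-term recurrence with
    coefficient 4 ((n + 1)^2 - w^2). It is written factored, to match the new factors of the two
    rising products. *)
Lemma cosine_moment_S (w : C) (n : nat) :
  RtoC 4 * (w + RtoC (INR n) + RtoC 1) * (RtoC (INR n) + RtoC 1 - w)
    * cosine_moment w (S n) =
  RtoC ((2 * INR n + 2) * (2 * INR n + 1)) * cosine_moment w n.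
Proof.
destruct w as [x y]. unfold cosine_moment; simpl Re; simpl Im.
set (a := (2 * x)%R); set (b := (2 * y)%R).
assert (Hc := cos_moment_S _ _ _ _ n (is_derive_coscosh a b)
  (is_derive2_coscosh a b) (is_derive_comb _ _ _ _ (b ^ 2 - a ^ 2) (2 * a * b)
     (is_derive_coscosh a b) (is_derive_msinsinh a b))).
assert (Hs := cos_moment_S _ _ _ _ n (is_derive_msinsinh a b)
  (is_derive2_msinsinh a b) (is_derive_comb _ _ _ _ (b ^ 2 - a ^ 2) (- (2 * a * b))
     (is_derive_msinsinh a b) (is_derive_coscosh a b))).
rewrite (cos_moment_linear _ _ _ _ _ _ _ (is_derive_coscosh a b)
  (is_derive_msinsinh a b)) in Hc.
rewrite (cos_moment_linear _ _ _ _ _ _ _ (is_derive_msinsinh a b)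
  (is_derive_coscosh a b)) in Hs.
rewrite cossinh_0, sincosh_0 in Hc, Hs.
specialize (Hc ltac:(ring)). specialize (Hs ltac:(ring)).
unfold a, b in *.
apply injective_projections; simpl; simpl in Hc, Hs; lra.
Qed.

Lemma is_RInt_cos_moment_0 (f f' : R -> R) :
  (forall t, is_derive f t (f' t)) ->
  is_RInt f 0 (PI / 2) (cos_moment f 0).
Proof.
intros Hf.
eapply is_RInt_ext; [|exact (is_RInt_cos_moment f f' 0 Hf)].
intros t _. apply Rmult_1_r.
Qed.

(** At n = 0 the cosine weight is 1, so this is the fundamental theorem of calculus. *)
Lemma cos_moment_0_derive (F f f' g g' : R -> R) (x y : R) :
  (forall t, is_derive F t (x * f t + y * g t)%R) ->
  (forall t, is_derive f t (f' t)) -> (forall t, is_derive g t (g' t)) ->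
  (x * cos_moment f 0 + y * cos_moment g 0 = F (PI / 2) - F 0)%R.
Proof.
intros HF Hf Hg.
rewrite <- (cos_moment_linear f f' g g' x y 0 Hf Hg).
assert (Hd := is_derive_comb _ _ _ _ x y Hf Hg).
transitivity (RInt (fun t => x * f t + y * g t)%R 0 (PI / 2)).
- symmetry. apply (is_RInt_unique (V := R_CompleteNormedModule)).
  exact (is_RInt_cos_moment_0 _ _ Hd).
- apply (is_RInt_unique (V := R_CompleteNormedModule)).
  apply (is_RInt_derive (V := R_CompleteNormedModule)); intros t _; [apply HF|].
  apply (ex_derive_continuous (V := R_NormedModule)). eexists. apply Hd.
Qed.

(** The primitive of 2 w cos(2 w t) is sin(2 w t), evaluated at 0 and PI / 2. *)
Lemma cosine_moment_0 (w : C) :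
  RtoC 2 * w * cosine_moment w 0 = Csin (RtoC PI * w).
Proof.
destruct w as [x y]. unfold cosine_moment, Csin; simpl Re; simpl Im.
assert (Hc := is_derive_coscosh (2 * x) (2 * y)).
assert (Hs := is_derive_msinsinh (2 * x) (2 * y)).
assert (H1 := cos_moment_0_derive _ _ _ _ _ _ _
  (is_derive_sincosh (2 * x) (2 * y)) Hc Hs).
assert (H2 := cos_moment_0_derive _ _ _ _ _ _ _
  (is_derive_cossinh (2 * x) (2 * y)) Hs Hc).
rewrite sincosh_0, Rminus_0_r in H1. rewrite cossinh_0, Rminus_0_r in H2.
unfold sincosh in H1; unfold cossinh in H2.
replace (2 * x * (PI / 2))%R with (PI * x)%R in H1, H2 by field.
replace (2 * y * (PI / 2))%R with (PI * y)%R in H1, H2 by field.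
replace (PI * x - 0 * y)%R with (PI * x)%R by ring.
replace (PI * y + 0 * x)%R with (PI * y)%R by ring.
rewrite <- H1, <- H2.
apply injective_projections; simpl; ring.
Qed.

(** * Limits of complex sequences and summable increments *)

(** Componentwise, in line with [CLim_seq], which takes the limits of the two parts separately. *)
Definition is_Clim_seq (u : nat -> C) (l : C) : Prop :=
  is_lim_seq (fun n => Re (u n)) (Re l) /\ is_lim_seq (fun n => Im (u n)) (Im l).

Lemma is_Clim_seq_const (l : C) : is_Clim_seq (fun _ => l) l.
Proof. split; apply is_lim_seq_const. Qed.

Lemma is_Clim_seq_mult (u v : nat -> C) (l l' : C) :
  is_Clim_seq u l -> is_Clim_seq v l' ->
  is_Clim_seq (fun n => u n * v n) (l * l').
Proof.
intros [Hu Hu'] [Hv Hv']. split.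
- rewrite re_mult.
  eapply is_lim_seq_ext; [intros n; symmetry; apply re_mult|].
  apply is_lim_seq_minus'; now apply is_lim_seq_mult'.
- rewrite im_mult.
  eapply is_lim_seq_ext; [intros n; symmetry; apply im_mult|].
  apply is_lim_seq_plus'; now apply is_lim_seq_mult'.
Qed.

Lemma is_Clim_seq_ext_loc (u v : nat -> C) (l : C) :
  eventually (fun n => u n = v n) -> is_Clim_seq u l -> is_Clim_seq v l.
Proof.
intros H [Hu Hv]. split; eapply is_lim_seq_ext_loc; try eassumption;
  revert H; apply filter_imp; intros n ->; reflexivity.
Qed.

Lemma is_Clim_seq_CLim_seq (u : nat -> C) (l : C) :
  is_Clim_seq u l -> CLim_seq u = l.
Proof.
intros [Hu Hv]. unfold CLim_seq.
rewrite (is_lim_seq_unique _ _ Hu), (is_lim_seq_unique _ _ Hv).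
symmetry. apply surjective_pairing.
Qed.

Lemma is_Clim_seq_unique (u : nat -> C) (l l' : C) :
  is_Clim_seq u l -> is_Clim_seq u l' -> l = l'.
Proof.
intros H H'.
now rewrite <- (is_Clim_seq_CLim_seq _ _ H), <- (is_Clim_seq_CLim_seq _ _ H').
Qed.

Lemma is_Clim_seq_cosine_moment (w : C) :
  is_Clim_seq (fun n => cosine_moment w n * RtoC (/ wallis n)) (RtoC 1).
Proof.
set (a := (2 * Re w)%R); set (b := (2 * Im w)%R).
assert (Hc := is_lim_seq_cos_moment _ _ _ _ (is_derive_coscosh a b)
  (is_derive2_coscosh a b) (is_derive_comb _ _ _ _ (b ^ 2 - a ^ 2) (2 * a * b)
     (is_derive_coscosh a b) (is_derive_msinsinh a b))).
assert (Hs := is_lim_seq_cos_moment _ _ _ _ (is_derive_msinsinh a b)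
  (is_derive2_msinsinh a b) (is_derive_comb _ _ _ _ (b ^ 2 - a ^ 2) (- (2 * a * b))
     (is_derive_msinsinh a b) (is_derive_coscosh a b))).
cbv beta in Hc, Hs.
rewrite cossinh_0, sincosh_0 in Hc, Hs.
specialize (Hc ltac:(ring)). specialize (Hs ltac:(ring)).
rewrite coscosh_0 in Hc. rewrite msinsinh_0 in Hs.
split; (eapply is_lim_seq_ext; [|eassumption]); intros n; simpl;
  unfold a, b, Rdiv; ring.
Qed.

Lemma Cmod_le_Rabs (c : C) : (Cmod c <= Rabs (Re c) + Rabs (Im c))%R.
Proof.
apply Rsqr_incr_0_var; [|generalize (Rabs_pos (Re c)) (Rabs_pos (Im c)); lra].
rewrite !Rsqr_pow2, Cmod2_alt.
generalize (Rabs_pos (Re c)) (Rabs_pos (Im c)).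
rewrite <- (pow2_abs (Re c)), <- (pow2_abs (Im c)). nra.
Qed.

Lemma im_le_Cmod (c : C) : (Rabs (Im c) <= Cmod c)%R.
Proof. eapply Rle_trans; [apply Rmax_r|apply Rmax_Cmod]. Qed.

(** The increments form an absolutely convergent series whose partial sums telescope to u (n + 1) -
    u 0. *)
Lemma is_lim_seq_of_increments (u e : nat -> R) :
  (forall n, Rabs (u (S n) - u n) <= e n)%R -> ex_series e ->
  exists l : R, is_lim_seq u l.
Proof.
intros H He.
destruct (ex_series_le (V := R_CompleteNormedModule)
  (fun n => u (S n) - u n)%R e H He) as [l Hl].
exists (l + u O)%R. apply is_lim_seq_incr_1.
eapply is_lim_seq_ext;
  [|apply is_lim_seq_plus'; [exact Hl|apply is_lim_seq_const]].
intros n. simpl. induction n as [|n IH].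
- rewrite sum_O. simpl. ring.
- rewrite sum_Sn. rewrite <- (Rplus_0_r (u (S (S n)))).
  unfold plus; simpl in *. lra.
Qed.

(** From |u (n + 1)| <= (1 + e n) |u n| <= exp(e n) |u n|, the sequence is bounded by |u 0| exp(sum
    of e). Relative increments then become absolute ones, summable in each component. This is the
    convergence criterion for infinite products. *)
Lemma is_Clim_seq_of_relative_increments (u : nat -> C) (e : nat -> R) :
  (forall n, 0 <= e n)%R ->
  (forall n, Cmod (u (S n) - u n) <= e n * Cmod (u n))%R -> ex_series e ->
  exists l, is_Clim_seq u l.
Proof.
intros He0 H He.
assert (HB : exists B, forall n, (Cmod (u n) <= B)%R).
{ exists (Cmod (u O) * exp (Series e))%R. intros n.
  assert (Hs : forall n, (Cmod (u (S n)) <= Cmod (u O) * exp (sum_n e n))%R).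
  { clear n. assert (Hstep : forall n,
      (Cmod (u (S n)) <= Cmod (u n) * exp (e n))%R).
    { intros n. replace (u (S n)) with (u n + (u (S n) - u n)) by ring.
      eapply Rle_trans; [apply Cmod_triangle|].
      apply Rle_trans with (Cmod (u n) * (1 + e n))%R.
      - generalize (H n). lra.
      - apply Rmult_le_compat_l; [apply Cmod_ge_0|apply exp_ineq1_le]. }
    induction n as [|n IH].
    - rewrite sum_O. apply Hstep.
    - rewrite sum_Sn. unfold plus; simpl. rewrite exp_plus, <- Rmult_assoc.
      eapply Rle_trans; [apply Hstep|].
      apply Rmult_le_compat_r; [left; apply exp_pos|exact IH]. }
  assert (Hsum : forall n, (sum_n e n <= Series e)%R).
  { clear n. intros n.
    apply (is_lim_seq_incr_compare (sum_n e) (Series e)).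
    - exact (Series_correct _ He).
    - intros k. rewrite sum_Sn. unfold plus; simpl.
      generalize (He0 (S k)). lra. }
  destruct n as [|n].
  - rewrite <- (Rmult_1_r (Cmod (u O))) at 1.
    apply Rmult_le_compat_l; [apply Cmod_ge_0|].
    generalize (exp_ineq1_le (Series e)) (Hsum O) (He0 O). rewrite sum_O. lra.
  - eapply Rle_trans; [apply Hs|].
    apply Rmult_le_compat_l; [apply Cmod_ge_0|].
    destruct (Hsum n) as [Hlt|Heq]; [left; now apply exp_increasing|].
    rewrite Heq. apply Rle_refl. }
destruct HB as [B HB].
assert (HeB : ex_series (fun n => B * e n)%R)
  by exact (ex_series_scal_l B e He).
assert (Hd : forall n, (Cmod (u (S n) - u n) <= B * e n)%R).
{ intros n. eapply Rle_trans; [apply H|]. rewrite Rmult_comm.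
  apply Rmult_le_compat_r; [apply He0|apply HB]. }
destruct (is_lim_seq_of_increments (fun n => Re (u n)) _
  (fun n => Rle_trans _ _ _ (re_le_Cmod (u (S n) - u n)) (Hd n)) HeB) as [l1 H1].
destruct (is_lim_seq_of_increments (fun n => Im (u n)) _
  (fun n => Rle_trans _ _ _ (im_le_Cmod (u (S n) - u n)) (Hd n)) HeB) as [l2 H2].
exists (l1, l2). now split.
Qed.

Lemma ex_series_inv_consecutive :
  ex_series (fun n => / ((INR n + 1) * (INR n + 2)))%R.
Proof.
exists 1%R.
(* The series telescopes, with partial sums 1 - 1 / (n + 2). *)
assert (H : is_lim_seq (fun n => 1 - 1 / (1 * INR n + 2))%R (1 - 0)%R).
{ apply is_lim_seq_minus'; [apply is_lim_seq_const|].
  apply is_lim_seq_inv_INR; lra. }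
rewrite Rminus_0_r in H. revert H.
apply is_lim_seq_ext. intros n.
induction n as [|n IH].
- rewrite sum_O. simpl. field.
- rewrite sum_Sn, <- IH. unfold plus; simpl plus. rewrite !S_INR.
  generalize (pos_INR n). intros. simpl. field. lra.
Qed.

(** * Convergence of the Euler-Gauss sequence *)

(** Subtracting the linear term from each of the two parts of exp(w t) makes its derivative vanish
    at 0, so [quadratic_bound] applies on [0, 1]. *)
Lemma Cexp_taylor (w : C) :
  exists K, (0 <= K)%R /\ forall x, (0 <= x <= 1)%R ->
    (Cmod (Cexp (w * RtoC x) - RtoC 1 - w * RtoC x) <= K * x ^ 2)%R.
Proof.
destruct w as [a b].
set (C0 := fun t => (exp (a * t) * cos (b * t))%R).
set (S0 := fun t => (exp (a * t) * sin (b * t))%R).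
assert (HC : forall t, is_derive C0 t (a * C0 t + (- b) * S0 t)%R).
{ intros t. unfold C0, S0. auto_derive; [easy|]. ring. }
assert (HS : forall t, is_derive S0 t (a * S0 t + b * C0 t)%R).
{ intros t. unfold C0, S0. auto_derive; [easy|]. ring. }
assert (HC0 : C0 0%R = 1%R)
  by (unfold C0; rewrite !Rmult_0_r, exp_0, cos_0; ring).
assert (HS0 : S0 0%R = 0%R)
  by (unfold S0; rewrite !Rmult_0_r, exp_0, sin_0; ring).
assert (Hlin : forall c t, is_derive (fun t => c * t)%R t c)
  by (intros; auto_derive; [easy|ring]).
assert (Hcst : forall c t, is_derive (fun _ : R => c) t 0%R)
  by (intros; auto_derive; easy).
destruct (quadratic_bound
  (fun t => 1 * C0 t + (-1) * (a * t))%R _ _ _ 1 ltac:(lra)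
  (is_derive_comb _ _ _ _ 1 (-1) HC (Hlin a))
  (is_derive_comb _ _ _ _ 1 (-1) (is_derive_comb _ _ _ _ a (-b) HC HS) (Hcst a))
  (is_derive_comb _ _ _ _ 1 (-1)
    (is_derive_comb _ _ _ _ a (-b) (is_derive_comb _ _ _ _ a (-b) HC HS)
       (is_derive_comb _ _ _ _ a b HS HC)) (Hcst 0%R))
  ltac:(cbv beta; rewrite HC0, HS0; ring)) as [K1 [HK1 H1]].
destruct (quadratic_bound
  (fun t => 1 * S0 t + (-1) * (b * t))%R _ _ _ 1 ltac:(lra)
  (is_derive_comb _ _ _ _ 1 (-1) HS (Hlin b))
  (is_derive_comb _ _ _ _ 1 (-1) (is_derive_comb _ _ _ _ a b HS HC) (Hcst b))
  (is_derive_comb _ _ _ _ 1 (-1)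
    (is_derive_comb _ _ _ _ a b (is_derive_comb _ _ _ _ a b HS HC)
       (is_derive_comb _ _ _ _ a (-b) HC HS)) (Hcst 0%R))
  ltac:(cbv beta; rewrite HC0, HS0; ring)) as [K2 [HK2 H2]].
exists (K1 + K2)%R. split; [lra|].
intros x Hx. eapply Rle_trans; [apply Cmod_le_Rabs|].
rewrite Rmult_plus_distr_r.
apply Rplus_le_compat.
- eapply Rle_trans; [|exact (H1 x Hx)]. right. f_equal. cbv beta.
  rewrite HC0. unfold C0, Cexp; simpl.
  replace (a * x - b * 0)%R with (a * x)%R by ring.
  replace (a * 0 + b * x)%R with (b * x)%R by ring. ring.
- eapply Rle_trans; [|exact (H2 x Hx)]. right. f_equal. cbv beta.
  rewrite HS0. unfold S0, Cexp; simpl.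
  replace (a * x - b * 0)%R with (a * x)%R by ring.
  replace (a * 0 + b * x)%R with (b * x)%R by ring. ring.
Qed.

(** This is 1 + u <= exp u for u = (y - x) / x. *)
Lemma ln_minus_le (x y : R) : (0 < x)%R -> (0 < y)%R -> (ln y - ln x <= (y - x) / x)%R.
Proof.
intros Hx Hy. rewrite <- ln_div by assumption.
rewrite <- (ln_exp ((y - x) / x)).
apply ln_le; [now apply Rdiv_lt_0_compat|].
replace (y / x)%R with (1 + (y - x) / x)%R by (field; lra).
apply exp_ineq1_le.
Qed.

Lemma ln_succ_bounds (x : R) :
  (0 < x)%R -> (/ (x + 1) <= ln (x + 1) - ln x <= / x)%R.
Proof.
intros Hx. split.
- assert (H := ln_minus_le (x + 1) x ltac:(lra) Hx).
  replace ((x - (x + 1)) / (x + 1))%R with (- / (x + 1))%R in H by (field; lra).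
  lra.
- assert (H := ln_minus_le x (x + 1) Hx ltac:(lra)).
  replace ((x + 1 - x) / x)%R with (/ x)%R in H by (field; lra).
  lra.
Qed.

Lemma Cpower_nonneg (x : R) (s : C) :
  (0 <= x)%R -> Cpower (RtoC x) 0 s = Cexp (s * RtoC (ln x)).
Proof.
intros Hx. unfold Cpower. rewrite Cmod_R, Rabs_pos_eq by assumption.
f_equal. ring.
Qed.

Lemma Gamma_pole_shift (w : C) (n : nat) :
  ~ Gamma_pole w -> w + RtoC (INR n) <> RtoC 0.
Proof.
intros H E. apply H. exists n.
replace w with (w + RtoC (INR n) - RtoC (INR n)) by ring.
rewrite E. ring.
Qed.

Lemma rising_neq_0 (w : C) (n : nat) : ~ Gamma_pole w -> rising w n <> RtoC 0.
Proof.
intros H. induction n as [|n IH].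
- simpl. intros E. apply (Gamma_pole_shift w 0 H). simpl. rewrite E. ring.
- apply Cmult_neq_0; [exact IH|]. exact (Gamma_pole_shift w (S n) H).
Qed.

(** The factor between consecutive terms is (n + 1) ((n + 1) / n)^w / (w + n + 1), to be shown to be
    1 + O(1/n^2). *)
Lemma Gamma_seq_S (w : C) (n : nat) :
  ~ Gamma_pole w -> (1 <= n)%nat ->
  Gamma_seq w (S n) =
  Gamma_seq w n * (RtoC (INR n + 1) * Cexp (w * RtoC (ln (INR n + 1) - ln (INR n)))
                   / (w + RtoC (INR n + 1))).
Proof.
intros Hw Hn. unfold Gamma_seq.
rewrite !Cpower_nonneg by apply pos_INR.
change (rising w (S n)) with (rising w n * (w + RtoC (INR (S n)))).
rewrite fact_simpl, mult_INR, RtoC_mult.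
assert (H1 := rising_neq_0 w n Hw).
assert (H2 := Gamma_pole_shift w (S n) Hw).
rewrite S_INR in *.
replace (w * RtoC (ln (INR n + 1)))
  with (w * RtoC (ln (INR n)) + w * RtoC (ln (INR n + 1) - ln (INR n)))
  by (rewrite RtoC_minus; ring).
rewrite Cexp_plus. field. now split.
Qed.

Lemma is_Clim_seq_Gamma_seq (w : C) :
  ~ Gamma_pole w -> is_Clim_seq (Gamma_seq w) (Gamma w).
Proof.
intros Hw.
enough (exists l, is_Clim_seq (Gamma_seq w) l) as [l Hl].
{ unfold Gamma. now rewrite (is_Clim_seq_CLim_seq _ _ Hl). }
destruct (Cexp_taylor w) as [K [HK0 HK]].
(* From n >= N on, |w| < (n + 1) / 2, hence |w + n + 1| >= (n + 1) / 2. *)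
destruct (nfloor_ex (2 * Cmod w) ltac:(generalize (Cmod_ge_0 w); lra)) as [N [_ HN]].
(* [M] is the constant of the numerator bound (2 K + |w|) / n, doubled by the division by (n + 1) /
   2. *)
set (M := (2 * (2 * K + Cmod w))%R).
assert (HM : (0 <= M)%R) by (unfold M; generalize (Cmod_ge_0 w); lra).
assert (Hrel : forall n, (1 <= n)%nat -> (N <= n)%nat ->
  (Cmod (Gamma_seq w (S n) - Gamma_seq w n) <=
   M * / (INR n * (INR n + 1)) * Cmod (Gamma_seq w n))%R).
{ intros n Hn1 HnN. rewrite Gamma_seq_S by assumption.
  apply le_INR in Hn1. apply le_INR in HnN. change (INR 1) with 1%R in Hn1.
  assert (H2 := Gamma_pole_shift w (S n) Hw). rewrite S_INR in H2.
  set (x := INR n) in *.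
  destruct (ln_succ_bounds x ltac:(lra)) as [Hl Hu].
  set (d := (ln (x + 1) - ln x)%R) in *.
  assert (Hx1 : (/ x <= 1)%R) by (rewrite <- Rinv_1; apply Rinv_le_contravar; lra).
  assert (Hd0 : (0 < / (x + 1))%R) by (apply Rinv_0_lt_compat; lra).
  assert (Hden : ((x + 1) / 2 <= Cmod (w + RtoC (x + 1)))%R).
  { assert (Ht := Cmod_triangle (w + RtoC (x + 1)) (- w)).
    replace (w + RtoC (x + 1) + - w) with (RtoC (x + 1)) in Ht by ring.
    rewrite Cmod_R, Cmod_opp, Rabs_pos_eq in Ht by lra. lra. }
  assert (Hnum : (Cmod (RtoC (x + 1) * Cexp (w * RtoC d) - (w + RtoC (x + 1)))
                  <= (2 * K + Cmod w) * / x)%R).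
  (* The Taylor remainder contributes at most 2 x K / x^2, as x + 1 <= 2 x and d <= 1 / x. The
     linear remainder contributes at most |w| / x, as (x + 1) d - 1 lies between 0 and 1 / x. *)
  { replace (RtoC (x + 1) * Cexp (w * RtoC d) - (w + RtoC (x + 1)))
      with (RtoC (x + 1) * (Cexp (w * RtoC d) - RtoC 1 - w * RtoC d)
            + w * RtoC ((x + 1) * d - 1))
      by (rewrite RtoC_minus, RtoC_mult; ring).
    eapply Rle_trans; [apply Cmod_triangle|].
    rewrite !Cmod_mult, !Cmod_R, (Rabs_pos_eq (x + 1)) by lra.
    rewrite (Rmult_plus_distr_r (2 * K)). apply Rplus_le_compat.
    - apply Rle_trans with ((2 * x) * (K * (/ x) ^ 2))%R.
      + apply Rmult_le_compat; [lra|apply Cmod_ge_0|lra|].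
        eapply Rle_trans; [apply HK; lra|].
        apply Rmult_le_compat_l; [assumption|]. apply pow_incr. lra.
      + right. field. lra.
    - apply Rmult_le_compat_l; [apply Cmod_ge_0|].
      apply Rabs_le. split.
      + apply Rle_trans with 0%R.
        * generalize (Rinv_0_lt_compat x ltac:(lra)). lra.
        * apply (Rmult_le_compat_l (x + 1)) in Hl; [|lra].
          rewrite Rinv_r in Hl; lra.
      + apply (Rmult_le_compat_l (x + 1)) in Hu; [|lra].
        replace ((x + 1) * / x)%R with (1 + / x)%R in Hu by (field; lra). lra. }
  replace (Gamma_seq w n * (RtoC (x + 1) * Cexp (w * RtoC d) / (w + RtoC (x + 1)))
           - Gamma_seq w n)
    with ((RtoC (x + 1) * Cexp (w * RtoC d) - (w + RtoC (x + 1)))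
          / (w + RtoC (x + 1)) * Gamma_seq w n) by (field; assumption).
  rewrite Cmod_mult, Cmod_div by assumption.
  apply Rmult_le_compat_r; [apply Cmod_ge_0|].
  apply Rle_trans with ((2 * K + Cmod w) * / x * / ((x + 1) / 2))%R.
  - apply Rmult_le_compat; [apply Cmod_ge_0| |exact Hnum|].
    + left. apply Rinv_0_lt_compat. lra.
    + apply Rinv_le_contravar; lra.
  - right. unfold M. field. lra. }
assert (Hser : ex_series (fun n => M * / ((INR n + 1) * (INR n + 2)))%R)
  by exact (ex_series_scal_l M _ ex_series_inv_consecutive).
(* The shift by [S N] makes every index at least 1 and at least N, and lets the bound be compared
   with the telescoping series. *)
destruct (is_Clim_seq_of_relative_increments
  (fun n => Gamma_seq w (n + S N))
  (fun n => M * / ((INR n + 1) * (INR n + 2)))%R) as [l [Hl1 Hl2]].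
- intros n. apply Rmult_le_pos; [assumption|].
  left. apply Rinv_0_lt_compat. generalize (pos_INR n). nra.
- intros n. eapply Rle_trans; [apply Hrel; lia|].
  apply Rmult_le_compat_r; [apply Cmod_ge_0|].
  apply Rmult_le_compat_l; [assumption|].
  rewrite plus_INR, S_INR. generalize (pos_INR n) (pos_INR N). intros.
  apply Rinv_le_contravar; nra.
- exact Hser.
- exists l. split; apply (is_lim_seq_incr_n _ (S N)); assumption.
Qed.

(** * Euler's reflection formula *)

(* [rising w n * rising (1 - w) n] is [n + 1 - w] times the partial product
   [w (1 - w^2) (2^2 - w^2) ... (n^2 - w^2)] of the sine. *)
Lemma rising_reflection (w : C) (n : nat) :
  ~ Gamma_pole (RtoC 1 - w) ->
  rising w n * rising (RtoC 1 - w) n * cosine_moment w n * RtoC PI =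
  (RtoC (INR n) + RtoC 1 - w) * RtoC (INR (fact n) ^ 2 * wallis n) *
  Csin (RtoC PI * w).
Proof.
intros Hw. induction n as [|n IH].
- rewrite wallis_0, <- cosine_moment_0. simpl.
  replace (RtoC PI) with (RtoC 2 * RtoC (PI / 2)).
  + replace (1 * (1 * 1) * (PI / 2))%R with (PI / 2)%R by ring. ring.
  + rewrite <- RtoC_mult. f_equal. field.
- assert (Hn : RtoC (INR n) + RtoC 1 - w <> RtoC 0).
  { replace (RtoC (INR n) + RtoC 1 - w) with (RtoC 1 - w + RtoC (INR n)) by ring.
    now apply Gamma_pole_shift. }
  assert (HI := cosine_moment_S w n). assert (HW := wallis_S n).
  change (rising w (S n)) with (rising w n * (w + RtoC (INR (S n)))).
  change (rising (RtoC 1 - w) (S n))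
    with (rising (RtoC 1 - w) n * (RtoC 1 - w + RtoC (INR (S n)))).
  assert (HF : RtoC 4 * RtoC (INR (fact (S n)) ^ 2 * wallis (S n)) =
    RtoC ((2 * INR n + 2) * (2 * INR n + 1)) * RtoC (INR (fact n) ^ 2 * wallis n)).
  { rewrite fact_simpl, mult_INR, S_INR, <- !RtoC_mult. f_equal.
    replace (4 * (((INR n + 1) * INR (fact n)) ^ 2 * wallis (S n)))%R
      with ((2 * INR n + 2) * INR (fact n) ^ 2 * ((2 * INR n + 2) * wallis (S n)))%R
      by ring.
    rewrite HW. ring. }
  rewrite S_INR, RtoC_plus.
  set (N := RtoC (INR n)) in *.
  set (q := RtoC ((2 * INR n + 2) * (2 * INR n + 1))) in *.
  set (P := rising w n) in *. set (P' := rising (RtoC 1 - w) n) in *.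
  set (J := cosine_moment w n) in *. set (J' := cosine_moment w (S n)) in *.
  set (W := RtoC (INR (fact n) ^ 2 * wallis n)) in *.
  set (W' := RtoC (INR (fact (S n)) ^ 2 * wallis (S n))) in *.
  (* The factor 4 (n + 1 - w), nonzero because 1 - w is not a pole, is what must multiply the goal
     for the left side of [cosine_moment_S] to appear. *)
  assert (Hreg : forall x y,
    RtoC 4 * (N + RtoC 1 - w) * x = RtoC 4 * (N + RtoC 1 - w) * y -> x = y).
  { intros x y E.
    replace x with (RtoC 4 * (N + RtoC 1 - w) * x / (RtoC 4 * (N + RtoC 1 - w)))
      by (field; exact Hn).
    rewrite E. field. exact Hn. }
  apply Hreg.
  transitivity (P * P' * RtoC PI * (N + RtoC 1 + (RtoC 1 - w))
    * (RtoC 4 * (w + N + RtoC 1) * (N + RtoC 1 - w) * J')); [ring|].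
  rewrite HI.
  transitivity (q * (N + RtoC 1 + (RtoC 1 - w)) * (P * P' * J * RtoC PI)); [ring|].
  rewrite IH.
  transitivity ((N + RtoC 1 + (RtoC 1 - w)) * (N + RtoC 1 - w)
    * Csin (RtoC PI * w) * (q * W)); [ring|].
  rewrite <- HF. ring.
Qed.

(** By [rising_reflection], the product of the two Euler-Gauss terms, times sin(pi w) and (n + 1 -
    w) / n, equals pi times the normalised cosine moment. Letting n tend to infinity gives both
    sides. *)
Lemma Gamma_reflection (w : C) :
  ~ Gamma_pole w -> ~ Gamma_pole (RtoC 1 - w) ->
  Gamma w * Gamma (RtoC 1 - w) * Csin (RtoC PI * w) = RtoC PI.
Proof.
intros H1 H2.
(* This is the correction factor (n + 1 - w) / n, written as 1 + (1 - w) / n. *)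
assert (HL : is_Clim_seq (fun n => RtoC 1 + (RtoC 1 - w) * RtoC (1 / (1 * INR n + 0)))
               (RtoC 1)).
{ assert (H0 := is_lim_seq_inv_INR 1 1 0 ltac:(lra) ltac:(lra)).
  split.
  - apply is_lim_seq_ext with
      (fun n => 1 + Re (RtoC 1 - w) * (1 / (1 * INR n + 0)))%R.
    { intros n. simpl. ring. }
    replace (Re (RtoC 1)) with (1 + Re (RtoC 1 - w) * 0)%R by (simpl; ring).
    apply is_lim_seq_plus', is_lim_seq_mult'; try apply is_lim_seq_const; exact H0.
  - apply is_lim_seq_ext with
      (fun n => 0 + Im (RtoC 1 - w) * (1 / (1 * INR n + 0)))%R.
    { intros n. simpl. ring. }
    replace (Im (RtoC 1)) with (0 + Im (RtoC 1 - w) * 0)%R by (simpl; ring).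
    apply is_lim_seq_plus', is_lim_seq_mult'; try apply is_lim_seq_const; exact H0. }
assert (HG := is_Clim_seq_mult _ _ _ _ (is_Clim_seq_mult _ _ _ _
  (is_Clim_seq_mult _ _ _ _ (is_Clim_seq_Gamma_seq w H1)
     (is_Clim_seq_Gamma_seq (RtoC 1 - w) H2))
  (is_Clim_seq_const (Csin (RtoC PI * w)))) HL).
assert (HI := is_Clim_seq_mult _ _ _ _ (is_Clim_seq_const (RtoC PI))
  (is_Clim_seq_cosine_moment w)).
rewrite Cmult_1_r in HG, HI.
apply (is_Clim_seq_unique _ _ _ HG).
revert HI. apply is_Clim_seq_ext_loc.
(* The index 0 is excluded because of the division by n. *)
exists 1%nat. intros n Hn.
assert (HR := rising_reflection w n H2).
assert (HW := wallis_pos n).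
assert (Hf : (0 < INR (fact n))%R) by apply INR_fact_lt_0.
assert (Hn0 : (0 < INR n)%R) by (apply lt_0_INR; lia).
assert (Hr1 := rising_neq_0 w n H1). assert (Hr2 := rising_neq_0 _ n H2).
unfold Gamma_seq. rewrite !Cpower_nonneg by apply pos_INR.
assert (HE : Cexp (w * RtoC (ln (INR n))) * Cexp ((RtoC 1 - w) * RtoC (ln (INR n)))
             = RtoC (INR n)).
{ rewrite <- Cexp_plus.
  replace (w * RtoC (ln (INR n)) + (RtoC 1 - w) * RtoC (ln (INR n)))
    with (RtoC (ln (INR n))) by ring.
  now rewrite Cexp_RtoC, exp_ln. }
assert (HW0 : RtoC (wallis n) <> RtoC 0) by (intros E; injection E; lra).
assert (HN0 : RtoC (INR n) <> RtoC 0) by (intros E; injection E; lra).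
rewrite RtoC_mult, RtoC_pow in HR.
rewrite RtoC_inv by lra.
replace (1 / (1 * INR n + 0))%R with (/ INR n)%R by (field; lra).
rewrite RtoC_inv by lra.
set (e1 := Cexp (w * _)) in *. set (e2 := Cexp ((RtoC 1 - w) * _)) in *.
set (P := rising w n) in *. set (P' := rising (RtoC 1 - w) n) in *.
transitivity (P * P' * cosine_moment w n * RtoC PI
  / (P * P' * RtoC (wallis n))); [field; auto|].
rewrite HR.
transitivity (RtoC (INR (fact n)) ^ 2 * (e1 * e2) / (P * P')
  * Csin (RtoC PI * w) * (RtoC 1 + (RtoC 1 - w) * / RtoC (INR n)));
  [rewrite HE; field; auto|].
field. auto.
Qed.

(** Reflection at w and at 2 w, combined with sin(2 pi w) = 2 sin(pi w) cos(pi w), leaves the ratio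
    2 cos(pi w), the sum of the two exponentials. *)
Lemma Gamma_reflection_double (w : C) :
  ~ Gamma_pole (RtoC 2 * w) -> ~ Gamma_pole (RtoC 1 - RtoC 2 * w) ->
  Gamma w * Gamma (RtoC 1 - w) =
  (Cexp (Ci * (RtoC PI * w)) + Cexp (- (Ci * (RtoC PI * w)))) *
  (Gamma (RtoC 2 * w) * Gamma (RtoC 1 - RtoC 2 * w)).
Proof.
intros H1 H2. rewrite Cexp_Ci_plus_opp.
assert (R2 := Gamma_reflection _ H1 H2).
assert (R1 : Gamma w * Gamma (RtoC 1 - w) * Csin (RtoC PI * w) = RtoC PI).
{ apply Gamma_reflection.
  (* If w = - k then 2 w = - 2 k; if 1 - w = - k then 1 - 2 w = - (2 k + 1). *)
  - intros [k Hk]. apply H1. exists (2 * k)%nat.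
    rewrite Hk, mult_INR, RtoC_mult. change (INR 2) with 2%R. ring.
  - intros [k Hk]. apply H2. exists (2 * k + 1)%nat.
    rewrite plus_INR, mult_INR, RtoC_plus, RtoC_mult.
    change (INR 2) with 2%R. change (INR 1) with 1%R.
    replace w with (RtoC 1 - (RtoC 1 - w)) by ring. rewrite Hk. ring. }
replace (RtoC PI * (RtoC 2 * w)) with (RtoC 2 * (RtoC PI * w)) in R2 by ring.
rewrite Csin_double in R2.
assert (Hs : Csin (RtoC PI * w) <> RtoC 0).
{ intros E. rewrite E, Cmult_0_r in R1. injection R1. generalize PI_RGT_0. lra. }
set (s := Csin _) in *. set (c := Ccos _) in *.
set (X := Gamma w * _) in *. set (Y := Gamma (RtoC 2 * w) * _) in *.
replace X with (X * s / s) by (field; exact Hs).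
rewrite R1, <- R2. field. exact Hs.
Qed.

(** * Complex linearity of contour integrals *)

(** The two parts of c f are real combinations of those of f, so the integral is computed by
    components. *)
Lemma is_RInt_Cmult (c : C) (f : R -> C) (a b : R) (l : C) :
  is_RInt (V := C_R_NormedModule) f a b l ->
  is_RInt (V := C_R_NormedModule) (fun t => c * f t) a b (c * l).
Proof.
intros H.
assert (H1 := is_RInt_fct_extend_fst
  (U := R_NormedModule) (V := R_NormedModule) f a b l H).
assert (H2 := is_RInt_fct_extend_snd
  (U := R_NormedModule) (V := R_NormedModule) f a b l H).
apply (is_RInt_fct_extend_pair (U := R_NormedModule) (V := R_NormedModule)).
- exact (is_RInt_minus _ _ _ _ _ _ (is_RInt_scal _ _ _ (fst c) _ H1)
          (is_RInt_scal _ _ _ (snd c) _ H2)).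
- exact (is_RInt_plus _ _ _ _ _ _ (is_RInt_scal _ _ _ (fst c) _ H2)
          (is_RInt_scal _ _ _ (snd c) _ H1)).
Qed.

Lemma continuous_Cmult_l (c l : C) :
  filterlim (fun x : C_R_NormedModule => c * x : C_R_NormedModule)
    (locally (l : C_R_NormedModule)) (locally (c * l : C_R_NormedModule)).
Proof.
apply (continuous_comp_2
   (fun x : C_R_NormedModule => (fst c * fst x - snd c * snd x)%R)
   (fun x : C_R_NormedModule => (fst c * snd x + snd c * fst x)%R)
   (fun u v : R => (u, v) : C_R_NormedModule)).
- apply (continuous_minus (V := R_NormedModule));
    apply (continuous_scal_r (V := R_NormedModule)); destruct l;
    [apply continuous_fst|apply continuous_snd].
- apply (continuous_plus (V := R_NormedModule));
    apply (continuous_scal_r (V := R_NormedModule)); destruct l;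
    [apply continuous_snd|apply continuous_fst].
- eapply continuous_ext; [|apply continuous_id]. now intros [u v].
Qed.

(** Multiplication by c is continuous, so a neighbourhood of c l pulls back to one of l, where the
    hypothesis applies. *)
Lemma is_RInt_gen_Cmult (c : C) (f : R -> C) (Fa Fb : (R -> Prop) -> Prop)
  (FFa : Filter Fa) (FFb : Filter Fb) (l : C) :
  is_RInt_gen (V := C_R_NormedModule) f Fa Fb l ->
  is_RInt_gen (V := C_R_NormedModule) (fun t => c * f t) Fa Fb (c * l).
Proof.
intros H P HP.
assert (HP' := continuous_Cmult_l c l P HP).
specialize (H _ HP').
revert H. unfold filtermapi. apply filter_imp.
intros [a b] [y [Hy Py]]. exists (c * y). split; [|exact Py].
now apply is_RInt_Cmult.
Qed.

(** The relation is asked only on the contour: off it, the identity between the integrands may fail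
    at poles of the Gamma factors. *)
Lemma CInt_linear (L : R -> C) (f g h : C -> C) (c d : C) :
  ex_CInt L g -> ex_CInt L h ->
  (forall t, f (L t) = c * g (L t) + d * h (L t)) ->
  CInt L f = c * CInt L g + d * CInt L h.
Proof.
intros [lg Hg] [lh Hh] Hf. unfold CInt.
rewrite (is_RInt_gen_unique (V := C_R_CompleteNormedModule) _ _ Hg),
  (is_RInt_gen_unique (V := C_R_CompleteNormedModule) _ _ Hh).
apply (is_RInt_gen_unique (V := C_R_CompleteNormedModule)).
eapply (is_RInt_gen_ext (V := C_R_NormedModule));
  [|exact (is_RInt_gen_plus (V := C_R_NormedModule) _ _ _ _
     (is_RInt_gen_Cmult c _ _ _ _ _ _ Hg) (is_RInt_gen_Cmult d _ _ _ _ _ _ Hh))].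
apply filter_forall. intros ab t _. unfold pullback. rewrite Hf.
unfold plus; simpl.
change (c * (g (L t) * velocity L t) + d * (h (L t) * velocity L t) =
  (c * g (L t) + d * h (L t)) * velocity L t). ring.
Qed.

(** * The identity between the integrands *)

(** The escaping path avoids L already at its starting point s. Hence no separated pole lies on the
    contour. *)
Lemma escapes_off_contour (L : R -> C) (s : C) (e : Rbar) (t : R) :
  escapes L s e -> s <> L t.
Proof. intros [w [<- [_ [H _]]]]. apply H. lra. Qed.

Lemma Cmod_Cexp_imag (x : R) : Cmod (Cexp (Ci * RtoC x)) = 1%R.
Proof.
unfold Cmod, Cexp; simpl.
replace (0 * x - 1 * 0)%R with 0%R by ring.
replace (0 * 0 + 1 * x)%R with x by ring.
rewrite exp_0. transitivity (sqrt 1); [f_equal|exact sqrt_1].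
generalize (sin2_cos2 x). unfold Rsqr. lra.
Qed.

(** Rotation keeps the modulus and shifts the carried argument by exactly x, without reduction
    modulo 2 pi, so no branch correction appears. *)
Lemma Cpower_rotate (z s : C) (theta x : R) :
  Cpower (Cexp (Ci * RtoC x) * z) (theta + x) s =
  Cexp (Ci * RtoC x * s) * Cpower z theta s.
Proof.
unfold Cpower. rewrite Cmod_mult, Cmod_Cexp_imag, Rmult_1_l, <- Cexp_plus.
f_equal. rewrite RtoC_plus. ring.
Qed.

Lemma H_integrand_double (m n : nat) (z alpha s : C) (theta lambda : R)
  (aA bB : list (C * R)) :
  (1 <= m)%nat -> (1 <= n)%nat ->
  ~ Gamma_pole (RtoC 2 * alpha + RtoC (2 * lambda) * s) ->
  ~ Gamma_pole (RtoC 1 - RtoC 2 * alpha - RtoC (2 * lambda) * s) ->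
  H_integrand m n z theta ((alpha, lambda) :: aA) ((alpha, lambda) :: bB) s =
  Cexp (Ci * RtoC PI * alpha) *
    H_integrand m n (Cexp (- (Ci * RtoC PI * RtoC lambda)) * z)
      (theta - PI * lambda)
      ((RtoC 2 * alpha, (2 * lambda)%R) :: aA)
      ((RtoC 2 * alpha, (2 * lambda)%R) :: bB) s +
  Cexp (- (Ci * RtoC PI * alpha)) *
    H_integrand m n (Cexp (Ci * RtoC PI * RtoC lambda) * z)
      (theta + PI * lambda)
      ((RtoC 2 * alpha, (2 * lambda)%R) :: aA)
      ((RtoC 2 * alpha, (2 * lambda)%R) :: bB) s.
Proof.
intros Hm Hn H1 H2.
(* Since m and n are positive, the leading parameters contribute Gamma(w) Gamma(1 - w), or the same
   at 2 w, to the numerator; all other factors are common to the three kernels. *)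
destruct m as [|m]; [lia|]. destruct n as [|n]; [lia|].
set (w := alpha + RtoC lambda * s).
replace (RtoC 2 * alpha + RtoC (2 * lambda) * s) with (RtoC 2 * w) in H1
  by (unfold w; rewrite RtoC_mult; ring).
replace (RtoC 1 - RtoC 2 * alpha - RtoC (2 * lambda) * s)
  with (RtoC 1 - RtoC 2 * w) in H2
  by (unfold w; rewrite RtoC_mult; ring).
assert (HG := Gamma_reflection_double w H1 H2).
unfold H_integrand, H_kernel, Cprod; cbn [firstn skipn map fold_right fst snd].
replace (RtoC 2 * alpha + RtoC (2 * lambda) * s) with (RtoC 2 * w)
  by (unfold w; rewrite RtoC_mult; ring).
replace (RtoC 1 - RtoC 2 * alpha - RtoC (2 * lambda) * s)
  with (RtoC 1 - RtoC 2 * w)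
  by (unfold w; rewrite RtoC_mult; ring).
replace (RtoC 1 - alpha - RtoC lambda * s) with (RtoC 1 - w) by (unfold w; ring).
fold w.
replace (Ci * RtoC PI * RtoC lambda) with (Ci * RtoC (PI * lambda))
  by (rewrite RtoC_mult; ring).
replace (- (Ci * RtoC (PI * lambda))) with (Ci * RtoC (- (PI * lambda)))
  by (rewrite RtoC_opp; ring).
unfold Rminus. rewrite !Cpower_rotate.
set (B := fold_right _ _ (map _ (firstn m bB))).
set (A := fold_right _ _ (map _ (firstn n aA))).
unfold Cdiv. set (D := / _). set (Z := Cpower z theta (- s)).
transitivity (Gamma w * Gamma (RtoC 1 - w) * (A * B * D * Z)); [ring|].
rewrite HG.
(* The exponent i pi w splits into i pi alpha, the constant prefactor, and (- i pi lambda)(- s), the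
   factor produced by rotating z in the power z^(-s). *)
replace (Ci * (RtoC PI * w))
  with (Ci * RtoC PI * alpha + Ci * RtoC (- (PI * lambda)) * - s)
  by (unfold w; rewrite RtoC_opp, RtoC_mult; ring).
replace (- (Ci * RtoC PI * alpha + Ci * RtoC (- (PI * lambda)) * - s))
  with (- (Ci * RtoC PI * alpha) + Ci * RtoC (PI * lambda) * - s)
  by (rewrite RtoC_opp; ring).
rewrite !Cexp_plus. ring.
Qed.

Theorem theorem4p1
  (z : C) (theta : R) (m n p q : nat)
  (alpha : C) (lambda : R) (aA bB : list (C * R)) (L : R -> C)
  (Hz : z <> RtoC 0)
  (Htheta : z = RtoC (Cmod z) * Cexp (Ci * RtoC theta))
  (Hm : (1 <= m <= q)%nat) (Hn : (1 <= n <= p)%nat)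
  (Hp : S (length aA) = p) (Hq : S (length bB) = q)
  (Hlambda : (0 < lambda)%R)
  (HA : List.Forall (fun x : C * R => (0 < snd x)%R) aA)
  (HB : List.Forall (fun x : C * R => (0 < snd x)%R) bB)
  (Hex : H_exists L m n z theta
           ((alpha, lambda) :: aA) ((alpha, lambda) :: bB))
  (Hex_minus : H_exists L m n
           (Cexp (- (Ci * RtoC PI * RtoC lambda)) * z) (theta - PI * lambda)%R
           ((RtoC 2 * alpha, (2 * lambda)%R) :: aA)
           ((RtoC 2 * alpha, (2 * lambda)%R) :: bB))
  (Hex_plus : H_exists L m n
           (Cexp (Ci * RtoC PI * RtoC lambda) * z) (theta + PI * lambda)%R
           ((RtoC 2 * alpha, (2 * lambda)%R) :: aA)
           ((RtoC 2 * alpha, (2 * lambda)%R) :: bB)) :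
  H_fun L m n z theta ((alpha, lambda) :: aA) ((alpha, lambda) :: bB) =
  Cexp (Ci * RtoC PI * alpha) *
    H_fun L m n
      (Cexp (- (Ci * RtoC PI * RtoC lambda)) * z) (theta - PI * lambda)%R
      ((RtoC 2 * alpha, (2 * lambda)%R) :: aA)
      ((RtoC 2 * alpha, (2 * lambda)%R) :: bB) +
  Cexp (- (Ci * RtoC PI * alpha)) *
    H_fun L m n
      (Cexp (Ci * RtoC PI * RtoC lambda) * z) (theta + PI * lambda)%R
      ((RtoC 2 * alpha, (2 * lambda)%R) :: aA)
      ((RtoC 2 * alpha, (2 * lambda)%R) :: bB).
Proof.
destruct Hex_minus as [_ [[Hl Hr] Hi]]. destruct Hex_plus as [_ [_ Hi']].
unfold H_fun.
rewrite (CInt_linear L _ _ _ (Cexp (Ci * RtoC PI * alpha))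
  (Cexp (- (Ci * RtoC PI * alpha))) Hi Hi'); [ring|].
(* The first top and bottom entries are among those separated by L, as m and n are positive. A pole
   of Gamma at 2 w or at 1 - 2 w would place [L t] strictly to one side of its own contour. *)
intros t. apply H_integrand_double; [lia|lia| |]; intros Hpole.
- apply (escapes_off_contour L (L t) m_infty t); [|reflexivity].
  apply (Hl (RtoC 2 * alpha, (2 * lambda)%R)); [|exact Hpole].
  destruct m; [lia|]. now left.
- apply (escapes_off_contour L (L t) p_infty t); [|reflexivity].
  apply (Hr (RtoC 2 * alpha, (2 * lambda)%R)); [|exact Hpole].
  destruct n; [lia|]. now left.
Qed.
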